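(* Let $p$ be a prime and let $(A,+,\cdot)$ be a pre-Lie algebra over $\mathbb{F}_p$ with $(A,+)\cong C_p^5$, generated by a single element $x$ as a pre-Lie algebra. Suppose $A^{[4]}\neq 0$, $A^{[5]}=0$ and $\dim_{\mathbb{F}_p}A^{[4]}=2$. Then the following hold. (1) There exists $u\in\{x^2\cdot x,\ x\cdot x^2\}$ such that $\{x,\ x^2,\ u,\ x\cdot u,\ u\cdot x\}$ is a basis of $A$ as an $\mathbb{F}_p$-vector space. There exist $\alpha,\beta\in\mathbb{F}_p$, not both zero, such that: (2) $\alpha\,x^2\cdot x+\beta\,x\cdot x^2\in A^{[4]}$; (3) $\alpha\,x\cdot(x^2\cdot x)+\beta\,x\cdot(x\cdot x^2)=\alpha\,(x^2\cdot x)\cdot x+\beta\,(x\cdot x^2)\cdot x=0$.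
   Context: A pre-Lie algebra over $\mathbb{F}_p$ is an $\mathbb{F}_p$-vector space $A$ with a bilinear product $\cdot$ satisfying $(a\cdot b)\cdot c-a\cdot(b\cdot c)=(b\cdot a)\cdot c-b\cdot(a\cdot c)$ for all $a,b,c\in A$. For subspaces $B,C\subseteq A$, $B\cdot C$ denotes the subspace spanned by all $b\cdot c$ with $b\in B$, $c\in C$. Define $A^{[1]}=A$ and $A^{[i+1]}=\sum_{j=1}^{i}A^{[j]}\cdot A^{[i+1-j]}$ for $i\ge 1$. Write $x^2=x\cdot x$. *)

(* Defs.v *)
From mathcomp Require Import all_boot all_algebra.

Set Implicit Arguments.
Unset Strict Implicit.
Unset Printing Implicit Defensive.

Import GRing.Theory.
Local Open Scope ring_scope.

Section PreLie.
Variables (K : fieldType) (A : vectType K).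

Definition pre_Lie (mul : A -> A -> A) : Prop :=
  forall a b c : A,
    mul (mul a b) c - mul a (mul b c) = mul (mul b a) c - mul b (mul a c).

Definition generated_by (mul : A -> A -> A) (x : A) : Prop :=
  forall B : {vspace A},
    x \in B -> {in B &, forall a b, mul a b \in B} -> B = fullv.

(* For bilinear mul, the products of basis vectors have the same span as all
   the products: see vprodP. *)
Definition vprod (mul : A -> A -> A) (B C : {vspace A}) : {vspace A} :=
  <<[seq mul b c | b <- vbasis B, c <- vbasis C]>>%VS.

(* The fuel k is sufficient as soon as i <= k; the index 0 is meaningless. *)
Fixpoint lpow_rec (mul : A -> A -> A) (k i : nat) : {vspace A} :=
  if k is k'.+1 then
    if (i <= 1)%N then fullv
    else (\sum_(1 <= j < i)
            vprod mul (lpow_rec mul k' j) (lpow_rec mul k' (i - j)))%VS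
  else fullv.

(* A^[i] *)
Definition lpow (mul : A -> A -> A) (i : nat) : {vspace A} := lpow_rec mul i i.

Lemma vprodP (mul : {bilinear A -> A -> A}) (B C W : {vspace A}) :
  reflect {in B & C, forall b c, mul b c \in W} (vprod mul B C <= W)%VS.
Proof.
apply: (iffP idP) => [sW b c /coord_vbasis-> /coord_vbasis->|sW].
  rewrite linear_sumlz; apply: memv_suml => i _.
  rewrite linear_sumr; apply: memv_suml => j _.
  rewrite linearZl_LR linearZr_LR !memvZ // (subvP sW) // memv_span //.
  apply/allpairsP; exists ((vbasis B)`_i, (vbasis C)`_j).
  by rewrite !memt_nth.
apply/span_subvP=> _ /allpairsP[[b c] /= [Bb Cc ->]].
by rewrite sW ?vbasis_mem.
Qed.

Lemma lpow_recE (mul : A -> A -> A) k i :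
  (i <= k)%N -> lpow_rec mul k i = lpow mul i.
Proof.
rewrite /lpow; elim/ltn_ind: i k => -[|[|i]] IH [|k] // le_ik.
apply: eq_big_nat => j /andP[j_gt0 lt_ji].
have lt_ij: (i.+2 - j < i.+2)%N by rewrite ltn_subrL j_gt0.
have eq_k m : (m < i.+2)%N -> lpow_rec mul k m = lpow_rec mul i.+1 m.
  move=> lt_mi; rewrite [LHS]IH ?[RHS]IH //.
  exact: leq_trans lt_mi le_ik.
by congr vprod; apply: eq_k.
Qed.

Lemma lpow1 (mul : A -> A -> A) : lpow mul 1 = fullv.
Proof. by []. Qed.

Lemma lpowS (mul : A -> A -> A) i : (0 < i)%N ->
  lpow mul i.+1 =
  (\sum_(1 <= j < i.+1) vprod mul (lpow mul j) (lpow mul (i.+1 - j)))%VS.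
Proof.
case: i => // i _; apply: eq_big_nat => j /andP[j_gt0 lt_ji].
have lt_ij: (i.+2 - j < i.+2)%N by rewrite ltn_subrL j_gt0.
by rewrite -(@lpow_recE mul i.+1 j) // -(@lpow_recE mul i.+1 (i.+2 - j)).
Qed.

End PreLie.

(* Main.v *)
Require Import Defs.
From mathcomp Require Import all_boot all_algebra.
Import GRing.Theory.
Local Open Scope ring_scope.

(** Write A^[i] for [lpow mul i].  The products of A respect this filtration
    ([lpow_mul], [lpow_anti]), so a product is determined modulo the next step
    by the leading terms of its factors ([lpow_mul_leading]).  As x generates
    A, each quotient A^[i] / A^[i+1] is therefore spanned by the monomials of
    degree i in x: by x for i = 1 ([lpow1_sub]), by x^2 for i = 2
    ([lpow2_sub]), and by a = x^2.x and b = x.x^2 for i = 3 ([lpow3_sub]).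

    The dimensions 5 and 2 of A and A^[4] force a and b to be dependent modulo
    A^[4] ([cubes_dependent]).  This is (2), and (3) follows by multiplying the
    relation by x, since A.A^[4] and A^[4].A lie in A^[5] = 0.

    The relation also makes one cube u in {a, b} span A^[3] modulo A^[4], so
    that A^[4] is spanned by x.u, u.x and x^2.x^2.  The pre-Lie identity for
    the triple (x^2, x, x) reads x^2.x^2 = a.x - b.x + x.a, and the right-hand
    side is a combination of u.x and x.u ([lpow4_sub]).  So the five elements
    in (1) span A, which has dimension 5 because it has p^5 elements
    ([card_bij_vectType]). *)

(** * The lower power filtration *)

Lemma lpow_mul (K : fieldType) (A : vectType K) (mul : {bilinear A -> A -> A})
    i j a b :
  (0 < i)%N -> (0 < j)%N -> a \in lpow mul i -> b \in lpow mul j ->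
  mul a b \in lpow mul (i + j).
Proof.
case: i j => // i [//|j] _ _ ai bj; rewrite addSn lpowS ?addnS //.
rewrite (big_rem i.+1) /=; last by rewrite mem_index_iota /= !ltnS leq_addr.
apply: (subvP (addvSl _ _)).
have -> : ((i + j).+2 - i.+1)%N = j.+1 by rewrite subSS subSn ?leq_addr ?addKn.
exact: (vprodP mul _ _ _ (subvv _)).
Qed.

Lemma lpowS_subv (K : fieldType) (A : vectType K)
    (mul : {bilinear A -> A -> A}) i (W : {vspace A}) :
  (0 < i)%N ->
  (forall j k a b, (0 < j)%N -> (0 < k)%N -> (j + k = i.+1)%N ->
     a \in lpow mul j -> b \in lpow mul k -> mul a b \in W) ->
  (lpow mul i.+1 <= W)%VS.
Proof.
move=> i_gt0 sW; rewrite lpowS // big_nat.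
apply: (big_ind (fun U : {vspace A} => (U <= W)%VS)) => [|U V sU sV|j].
- exact: sub0v.
- by rewrite subv_add sU.
case/andP=> j_gt0 lt_ji; apply/vprodP=> a b aj bk.
by apply: (sW j (i.+1 - j)%N); rewrite ?subn_gt0 // subnKC // ltnW.
Qed.

Lemma lpow_anti (K : fieldType) (A : vectType K) (mul : {bilinear A -> A -> A})
    i :
  (0 < i)%N -> (lpow mul i.+1 <= lpow mul i)%VS.
Proof.
elim/ltn_ind: i => -[//|[|i]] IH _; first by rewrite lpow1 subvf.
apply: lpowS_subv => // -[//|[|j]] k a b _ k_gt0 + aj bk.
  rewrite add1n => -[k_eq]; rewrite k_eq in bk.
  apply: (lpow_mul _ _ _ 1 i.+1) => //.
  by apply: subvP bk; apply: IH.
case: k k_gt0 bk => // k _ bk [jk_eq].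
have -> : i.+2 = (j.+1 + k.+1)%N by rewrite addSn jk_eq.
apply: lpow_mul => //.
apply: subvP aj; apply: IH => //.
by move: jk_eq; rewrite addnS => -[<-]; rewrite !ltnS leq_addr.
Qed.

(** A product of two elements of degrees i and j is governed, modulo degree
    i + j + 1, by the product of their leading terms. *)
Lemma lpow_mul_leading (K : fieldType) (A : vectType K)
    (mul : {bilinear A -> A -> A}) i j s t a b :
  (0 < i)%N -> (0 < j)%N -> s \in lpow mul i -> t \in lpow mul j ->
  a \in (<[s]> + lpow mul i.+1)%VS -> b \in (<[t]> + lpow mul j.+1)%VS ->
  mul a b \in (<[mul s t]> + lpow mul (i + j).+1)%VS.
Proof.
move=> i_gt0 j_gt0 si tj /memv_addP[_ /vlineP[k ->] [u u_i ->]].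
move=> /memv_addP[_ /vlineP[l ->] [v v_j ->]].
have b_j : l *: t + v \in lpow mul j.
  by rewrite memvD ?memvZ // (subvP (lpow_anti _ _ _ _ j_gt0)).
rewrite linearDl linearZl_LR /= [mul s (_ + _)]linearDr linearZr_LR /=.
rewrite scalerDr scalerA -addrA memv_add ?memvZ ?memv_line //.
rewrite memvD ?memvZ //; first by rewrite -addnS lpow_mul.
by rewrite -addSn lpow_mul.
Qed.

(** * Monogenic algebras: monomials in the generator span each degree *)

Lemma lpow1_sub (K : fieldType) (A : vectType K) (mul : {bilinear A -> A -> A})
    x a :
  generated_by mul x -> a \in (<[x]> + lpow mul 2)%VS.
Proof.
move=> x_gen; rewrite (x_gen (<[x]> + lpow mul 2)%VS) ?memvf //.
  by rewrite (subvP (addvSl _ _)) ?memv_line.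
move=> b c _ _; apply: (subvP (addvSr _ _)).
by apply: (lpow_mul _ _ _ 1 1); rewrite ?lpow1 ?memvf.
Qed.

Lemma lpow2_sub (K : fieldType) (A : vectType K) (mul : {bilinear A -> A -> A})
    x :
  generated_by mul x -> (lpow mul 2 <= <[mul x x]> + lpow mul 3)%VS.
Proof.
move=> x_gen; apply: lpowS_subv => // -[//|[|j]] [//|[|k]] a b _ _;
  rewrite !(addSn, addnS) // => _ _ _.
by apply: (lpow_mul_leading _ _ _ 1 1); rewrite ?lpow1 ?memvf // lpow1_sub.
Qed.

Lemma square_lpow2 (K : fieldType) (A : vectType K)
    (mul : {bilinear A -> A -> A}) x : mul x x \in lpow mul 2.
Proof. by apply: (lpow_mul _ _ _ 1 1); rewrite ?lpow1 ?memvf. Qed.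

Lemma lpow3_sub (K : fieldType) (A : vectType K) (mul : {bilinear A -> A -> A})
    x :
  generated_by mul x ->
  (lpow mul 3 <=
     <[mul (mul x x) x]> + <[mul x (mul x x)]> + lpow mul 4)%VS.
Proof.
move=> x_gen; have x2_2 := square_lpow2 _ _ mul x.
have sub2 := subvP (lpow2_sub _ _ _ _ x_gen).
apply: lpowS_subv => // -[//|[|[|j]]] [//|[|[|k]]] a b _ _;
  rewrite !(addSn, addnS) // => _ a_i b_j.
  apply: (subvP (addvS (addvSr _ _) (subvv _))).
  by apply: (lpow_mul_leading _ _ _ 1 2); rewrite ?lpow1_sub ?sub2 ?memvf.
apply: (subvP (addvS (addvSl _ _) (subvv _))).
by apply: (lpow_mul_leading _ _ _ 2 1); rewrite ?lpow1_sub ?sub2 ?memvf.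
Qed.

Lemma cubes_lpow3 (K : fieldType) (A : vectType K)
    (mul : {bilinear A -> A -> A}) x :
  mul (mul x x) x \in lpow mul 3 /\ mul x (mul x x) \in lpow mul 3.
Proof.
have x2_2 := square_lpow2 _ _ mul x.
split; first by apply: (lpow_mul _ _ _ 2 1); rewrite ?lpow1 ?memvf.
by apply: (lpow_mul _ _ _ 1 2); rewrite ?lpow1 ?memvf.
Qed.

(** * The two cubes of the generator *)

(** If a = x^2.x is in A^[4], then a itself is a relation.  Otherwise x^2 is
    not in A^[3], hence x is not in A^[2]: the first two steps of the filtration
    are strict, which leaves at most one dimension for A^[3] / A^[4], so a spans
    it. *)
Lemma cubes_dependent (K : fieldType) (A : vectType K)
    (mul : {bilinear A -> A -> A}) x :
  (\dim {:A} <= (\dim (lpow mul 4)).+3)%N ->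
  exists alpha beta : K, ~ (alpha = 0 /\ beta = 0) /\
    alpha *: mul (mul x x) x + beta *: mul x (mul x x) \in lpow mul 4.
Proof.
move=> dimA; have [a3 b3] := cubes_lpow3 _ _ mul x.
have x2_2 := square_lpow2 _ _ mul x.
have [a4|a4] := boolP (mul (mul x x) x \in lpow mul 4).
  exists 1, 0; split; first by case=> /eqP; rewrite oner_eq0.
  by rewrite scale1r scale0r addr0.
have x2_3 : mul x x \notin lpow mul 3.
  apply: contra a4 => x2_3.
  by apply: (lpow_mul _ _ _ 3 1); rewrite ?lpow1 ?memvf.
have x_2 : x \notin lpow mul 2.
  apply: contra x2_3 => x_2.
  by apply: (lpow_mul _ _ _ 2 1); rewrite ?lpow1 ?memvf.
have proper_dim (U V : {vspace A}) v :
    (U <= V)%VS -> v \in V -> v \notin U -> (\dim U < \dim V)%N.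
  move=> sUV Vv; apply: contraR; rewrite -leqNgt => dimVU.
  by have /eqP-> : U == V by rewrite eqEdim sUV.
have lt21 : (\dim (lpow mul 2) < \dim {:A})%N.
  by apply: (proper_dim _ _ x); rewrite ?subvf ?memvf.
have lt32 : (\dim (lpow mul 3) < \dim (lpow mul 2))%N.
  by apply: (proper_dim _ _ (mul x x)); rewrite ?lpow_anti.
have le3 : (\dim (lpow mul 3) <= (\dim (lpow mul 4)).+1)%N.
  by rewrite -2!ltnS (leq_trans _ dimA) // (leq_ltn_trans lt32).
have eq3 : (<[mul (mul x x) x]> + lpow mul 4)%VS = lpow mul 3.
  apply/eqP; rewrite eqEdim subv_add -memvE a3 lpow_anti //=.
  apply: leq_trans le3 _; apply: (proper_dim _ _ (mul (mul x x) x)) => //.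
    exact: addvSr.
  by rewrite (subvP (addvSl _ _)) ?memv_line.
move: b3; rewrite -eq3 => /memv_addP[_ /vlineP[k ->] [w w4 ->]].
exists (- k), 1; split; first by case=> _ /eqP; rewrite oner_eq0.
by rewrite scale1r scaleNr addKr.
Qed.

(** The relation is solved for the cube whose coefficient is nonzero; the other
    cube is u. *)
Lemma one_cube_spans (K : fieldType) (A : vectType K)
    (mul : {bilinear A -> A -> A}) x (alpha beta : K) :
  generated_by mul x -> ~ (alpha = 0 /\ beta = 0) ->
  alpha *: mul (mul x x) x + beta *: mul x (mul x x) \in lpow mul 4 ->
  exists u : A, (u = mul (mul x x) x \/ u = mul x (mul x x)) /\
    (lpow mul 3 <= <[u]> + lpow mul 4)%VS.
Proof.
move=> x_gen ab_neq0 rel.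
have sub3 := lpow3_sub _ _ _ _ x_gen.
have solve (c d : K) (v w : A) : c != 0 -> c *: v + d *: w \in lpow mul 4 ->
    v \in (<[w]> + lpow mul 4)%VS.
  move=> c_neq0 vw4; apply/memv_addP.
  exists (- (c^-1 * d) *: w); first by rewrite memvZ ?memv_line.
  exists (c^-1 *: (c *: v + d *: w)); first exact: memvZ.
  by rewrite scalerDr !scalerA mulVf // scale1r scaleNr addrCA addNr addr0.
have [alpha0|alpha_neq0] := eqVneq alpha 0.
  exists (mul (mul x x) x); split; first by left.
  apply: subv_trans sub3 _.
  rewrite !subv_add addvSl addvSr andbT -memvE.
  apply: (solve beta alpha); last by rewrite addrC.
  by apply/eqP=> beta0; apply: ab_neq0.
exists (mul x (mul x x)); split; first by right.
apply: subv_trans sub3 _.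
rewrite !subv_add addvSl addvSr !andbT -memvE.
exact: (solve alpha beta).
Qed.

(** * The last nonzero step *)

(** The only product of degree 4 that does not involve a cube is x^2.x^2, and
    the pre-Lie identity for (x^2, x, x) rewrites it with products of x and
    the cubes. *)
Lemma lpow4_sub (K : fieldType) (A : vectType K) (mul : {bilinear A -> A -> A})
    x u :
  pre_Lie mul -> generated_by mul x -> lpow mul 5 = 0%VS ->
  u \in lpow mul 3 -> (lpow mul 3 <= <[u]> + lpow mul 4)%VS ->
  (lpow mul 4 <= <[mul x u]> + <[mul u x]>)%VS.
Proof.
move=> preLie x_gen A5 u3 /subvP sub3.
have x2_2 := square_lpow2 _ _ mul x.
have [a3 b3] := cubes_lpow3 _ _ mul x.
have sub2 := subvP (lpow2_sub _ _ _ _ x_gen).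
have line31 c d : c \in lpow mul 3 -> mul c d \in <[mul u x]>%VS.
  move=> c3; rewrite -[<[_]>%VS]addv0 -A5.
  by apply: (lpow_mul_leading _ _ _ 3 1); rewrite ?lpow1_sub ?sub3 ?memvf.
have line13 c d : c \in lpow mul 3 -> mul d c \in <[mul x u]>%VS.
  move=> c3; rewrite -[<[_]>%VS]addv0 -A5.
  by apply: (lpow_mul_leading _ _ _ 1 3); rewrite ?lpow1_sub ?sub3 ?memvf.
have line22 c d : c \in lpow mul 2 -> d \in lpow mul 2 ->
    mul c d \in <[mul (mul x x) (mul x x)]>%VS.
  move=> c2 d2; rewrite -[<[_]>%VS]addv0 -A5.
  by apply: (lpow_mul_leading _ _ _ 2 2); rewrite ?sub2.
have x2x2 : mul (mul x x) (mul x x) \in (<[mul x u]> + <[mul u x]>)%VS.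
  have := preLie (mul x x) x x.
  move=> /(canRL (subrK _)) /(canLR (addKr _)) <-.
  apply: memvD; last by rewrite (subvP (addvSr _ _)) ?line31.
  rewrite memvN memvB //; first by rewrite (subvP (addvSr _ _)) ?line31.
  by rewrite (subvP (addvSl _ _)) ?line13.
apply: lpowS_subv => // -[//|[|[|[|j]]]] [//|[|[|[|k]]]] a b _ _;
  rewrite !(addSn, addnS) // => _ a_i b_j.
- by rewrite (subvP (addvSl _ _)) ?line13.
- by have /vlineP[k ->] := line22 _ _ a_i b_j; rewrite memvZ.
by rewrite (subvP (addvSr _ _)) ?line31.
Qed.

(** * Dimension by counting, and the basis *)

Lemma card_bij_vectType (K : finFieldType) (A : vectType K) (T : finType)
    (f : A -> T) :
  bijective f -> #|T| = (#|K| ^ \dim {:A})%N.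
Proof.
move=> f_bij; have r2v_bij : bijective (@VectorInternalTheory.r2v K A).
  exists VectorInternalTheory.v2r.
    exact: VectorInternalTheory.r2vK.
  exact: VectorInternalTheory.v2rK.
by rewrite -(bij_eq_card (bij_comp f_bij r2v_bij)) card_mx mul1n dimvf.
Qed.

Theorem theorem4p4p2 (p : nat) (p_prime : prime p)
    (A : vectType 'F_p) (mul : {bilinear A -> A -> A}) (mul_pre_Lie : pre_Lie mul)
    (A_iso : exists f : {additive A -> 'rV['Z_p]_5}, bijective f)
    (x : A) (x_gen : generated_by mul x)
    (A4_neq0 : lpow mul 4 <> 0%VS) (A5_eq0 : lpow mul 5 = 0%VS)
    (dim_A4 : \dim (lpow mul 4) = 2%N) :
  (exists u : A,
      (u = mul (mul x x) x \/ u = mul x (mul x x)) /\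
      basis_of fullv [:: x; mul x x; u; mul x u; mul u x]) /\
  (exists alpha beta : 'F_p,
      ~ (alpha = 0 /\ beta = 0) /\
      alpha *: mul (mul x x) x + beta *: mul x (mul x x) \in lpow mul 4 /\
      (alpha *: mul x (mul (mul x x) x) + beta *: mul x (mul x (mul x x)) = 0 /\
       alpha *: mul (mul (mul x x) x) x + beta *: mul (mul x (mul x x)) x = 0)).
Proof.
have dimA : \dim {:A} = 5%N.
  (* An additive bijection carries no scalar structure a priori, but it fixes
     the number p ^ dim A of elements. *)
  have [f /card_bij_vectType/eqP] := A_iso.
  rewrite card_mx mul1n card_Fp // card_ord Zp_cast ?prime_gt1 //.
  by rewrite eqn_exp2l ?prime_gt1 // => /eqP.
have [|alpha [beta [ab_neq0 rel]]] := cubes_dependent _ _ mul x.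
  by rewrite dimA dim_A4.
split; last first.
  exists alpha, beta; do 2![split=> //].
  split.
    have := lpow_mul _ _ mul 1 4 x _ isT isT (memvf x) rel.
    by rewrite A5_eq0 memv0 linearDr !linearZr_LR => /eqP.
  have := lpow_mul _ _ mul 4 1 _ x isT isT rel (memvf x).
  by rewrite A5_eq0 memv0 linearDl !linearZl_LR => /eqP.
have [u [u_eq sub3]] := one_cube_spans _ _ _ _ _ _ x_gen ab_neq0 rel.
exists u; split=> //.
have u3 : u \in lpow mul 3.
  by have [a3 b3] := cubes_lpow3 _ _ mul x; case: u_eq => ->.
have sub4 := lpow4_sub _ _ _ _ _ mul_pre_Lie x_gen A5_eq0 u3 sub3.
rewrite basisEdim dimA leqnn andbT.
apply/subvP => c _; apply: subvP (lpow1_sub _ _ _ _ c x_gen).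
rewrite !span_cons span_nil addv0.
apply: addvS => //; apply: subv_trans (lpow2_sub _ _ _ _ x_gen) _.
by apply: addvS => //; apply: subv_trans sub3 _; apply: addvS.
Qed.
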